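(* For all integers $n\ge1$ and $0\le k\le n$, $$c_q[n,k]=\sum_{T\in\mathcal{AR}(n,n-k)} q^{\mathrm{below}(T)}(1+q)^{\mathrm{nrow}(T)}.$$
   Context: The staircase board of length $m$ consists of the squares $(i,j)$ with integers $i,j\ge1$ and $i+j\le m$; $i$ is the row (row $1$ is the top row, with $m-1$ squares) and $j$ the column (numbered from the left; column $j$ has $m-j$ squares, left-justified rows). The squares below $(i,j)$ are the squares $(i',j)$ with $i'>i$; there are $m-i-j$ of them. Square $(i,j)$ is shaded if $m-i-j$ is even (so every other antidiagonal is shaded, starting with the lowest one). A placement of $r$ rooks is a set of $r$ squares, no two in the same column (two rooks may share a row); $\mathcal R(m,r)$ denotes the set of such placements, and $\mathcal{AR}(m,r)$ the subset in which every rook is on a shaded square. For a placement $T$, $\mathrm{below}(T)$ is the total number of squares lying below the rooks of $T$, and $\mathrm{nrow}(T)$ is the number of rooks of $T$ not in row $1$. Let $[k]_q=1+q+\cdots+q^{k-1}$ ($[0]_q=0$). The unsigned $q$-Stirling numbers of the first kind are defined by $c_q[n,k]=c_q[n-1,k-1]+[n-1]_q\,c_q[n-1,k]$ for $n\ge1$, $k\ge1$, with $c_q[n,0]=\delta_{n,0}$ and $c_q[n,k]=0$ for $k>n$. *)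

(* Defs.v *)
From mathcomp Require Import all_boot all_order all_algebra.

Set Implicit Arguments.
Unset Strict Implicit.
Unset Printing Implicit Defensive.

Import GRing.Theory.
Local Open Scope ring_scope.

(* Identities in q are identities in Z[q], with q = 'X. *)

Definition qnat (k : nat) : {poly int} := \sum_(i < k) 'X^i.

Fixpoint cq (n k : nat) : {poly int} :=
  match n, k with
  | 0, 0 => 1
  | 0, _.+1 => 0
  | _.+1, 0 => 0
  | n'.+1, k'.+1 => cq n' k' + qnat n' * cq n' k'.+1
  end.

Lemma cq_small (n k : nat) : (n < k)%N -> cq n k = 0.
Proof.
elim: n k => [|n IHn] [|k] //= lt_nk.
by rewrite !IHn ?mulr0 ?addr0 // ltnW.
Qed.

(* A square is (row, column), with both coordinates counted from 1. Squares of
   the staircase board of length m have coordinates at most m - 1, so 'I_m is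
   large enough; pairs with a zero coordinate are excluded by [board]. *)
Notation square m := ('I_m * 'I_m)%type.

Section Rooks.

Variable m : nat.
Implicit Types (s t : square m) (T : {set square m}).

Definition board : {set square m} :=
  [set s : square m | [&& (0 < s.1)%N, (0 < s.2)%N & (s.1 + s.2 <= m)%N]].

Definition shaded : {set square m} :=
  [set s : square m in board | ~~ odd (m - s.1 - s.2)%N].

Definition squares_below s : {set square m} :=
  [set t : square m in board | (t.2 == s.2) && (s.1 < t.1)%N].

Definition placements (r : nat) : {set {set square m}} :=
  [set T : {set square m} |
    [&& T \subset board, #|T| == r
      & [forall s in T, forall t in T, (s.2 == t.2) ==> (s == t)]]].

Definition alt_placements (r : nat) : {set {set square m}} :=
  [set T in placements r | T \subset shaded].

Definition below T : nat := (\sum_(s in T) #|squares_below s|)%N.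

Definition nrow T : nat := #|[set s : square m in T | s.1 != 1%N :> nat]|.

End Rooks.

(* Main.v *)
(** In column j >= 1 the shaded squares have total weight [n - j]_q: each pair
    q^e + q^(e+1), e even, is contributed by the shaded square with e squares
    below it, and a lone top power q^(n-j-1) by a shaded square of row 1. A
    placement chooses independently in each column at most one square, so the
    sum over placements of n - k rooks is the coefficient of X^k in
    X (X + [1]_q) ... (X + [n-1]_q), which is c_q[n, k]. *)
Require Import Defs.
From mathcomp Require Import all_boot all_order all_algebra.
From mathcomp Require Import zify.

Import GRing.Theory.
Local Open Scope ring_scope.

(** The factor X + [n]_q shifts the coefficients and adds [n]_q times them, which is the recurrence
    of [cq]. *)
Lemma coef_prod_qnat (n k : nat) :
  (\prod_(j < n) ('X + (qnat j)%:P))`_k = cq n k.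
Proof.
elim: n k => [|n IHn] k; first by rewrite big_ord0 coefC; case: k.
rewrite big_ord_recr /= mulrDr coefD coefMX coefMC !IHn.
case: k => [|k] /=; last by rewrite mulrC.
(* The constant coefficient vanishes: for [n = 0] because [0]_q = 0, otherwise because [cq] is zero
   there. *)
case: n {IHn} => [|n] /=; first by rewrite /qnat big_ord0 mulr0 addr0.
by rewrite mul0r addr0.
Qed.

(** Here [L] is the height of a column and [e] the number of squares below a shaded square;
    [e.+1 = L] singles out row 1. Powers are peeled off two at a time. *)
Lemma qnat_even_sum (L : nat) :
  \sum_(e < L | ~~ odd e) 'X^e * (1 + 'X) ^+ (e.+1 != L) = qnat L.
Proof.
have [m] := ubnP L; elim: m L => // m IHm [|[|L]] ltLm.
- by rewrite /qnat !big_ord0.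
- by rewrite /qnat big_mkcond !big_ord1 /= mulr1.
(* The term e = 0 gives 1 + q, the odd e = 1 gives 0, and the rest is q^2 times the sum for [L]. *)
rewrite /qnat big_mkcond 2!big_ord_recl /= 2![in RHS]big_ord_recl /=.
rewrite /bump /= !add1n expr0 expr1 mul1r add0r addrA.
congr (_ + _).
transitivity ('X^2 * qnat L : {poly int}).
  rewrite -IHm; last by lia.
  rewrite [in RHS]big_mkcond mulr_sumr; apply: eq_bigr => e _ /=.
  rewrite negbK !eqSS !add1n; case: ifP => _; last by rewrite mulr0.
  by rewrite mulrA -exprD.
by rewrite /qnat mulr_sumr; apply: eq_bigr => e _; rewrite -exprD.
Qed.

Section PartialFunctions.

Variable n : nat.
Implicit Types (f : {ffun 'I_n -> option 'I_n}) (s : square n)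
  (T : {set square n}).

Definition square_weight s : {poly int} :=
  'X^(#|squares_below s|) * (1 + 'X) ^+ (s.1 != 1%N :> nat).

(** Partial functions from columns to rows encode the sets with at most one square per column, so
    that a product over columns expands into a sum over them. *)
Definition rook_set f : {set square n} := [set s | f s.2 == Some s.1].

Definition column_choice T : {ffun 'I_n -> option 'I_n} :=
  [ffun j => [pick i | (i, j) \in T]].

Lemma rook_setK f : column_choice (rook_set f) = f.
Proof.
apply/ffunP => j; rewrite ffunE; case: pickP => [i|nof].
  by rewrite inE => /eqP.
by case fj: (f j) => [i|] //; have := nof i; rewrite inE /= fj eqxx.
Qed.

Lemma column_choiceK r T :
  T \in placements n r -> rook_set (column_choice T) = T.
Proof.
rewrite inE => /and3P[_ _ /forall_inP colT].
apply/setP => -[i j]; rewrite inE ffunE /=; case: pickP => [i' i'T|-> //].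
apply/eqP/idP => [[<-] //|iT]; have /forall_inP/(_ _ iT) := colT _ i'T.
by rewrite /= eqxx => /eqP[->].
Qed.

Lemma rook_set_placement r f :
  (rook_set f \in placements n r) =
  (rook_set f \subset board n) && (#|rook_set f| == r).
Proof.
rewrite inE; case: (_ \subset _) => //=; case: (_ == r) => //=.
apply/forall_inP => -[i j]; rewrite inE /= => /eqP fj.
apply/forall_inP => -[i' j']; rewrite inE /= => /eqP fj'.
by apply/implyP => /eqP ejj; move: fj; rewrite ejj fj' => -[->].
Qed.

Lemma big_rook_set (R : Type) (idx : R) (op : Monoid.com_law idx)
    (F : square n -> R) f :
  \big[op/idx]_(s in rook_set f) F s =
  \big[op/idx]_j (if f j is Some i then F (i, j) else idx).
Proof.
transitivity (\big[op/idx]_j \big[op/idx]_(i | f j == Some i) F (i, j)).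
  rewrite (exchange_big_dep xpredT) //= pair_big_dep.
  by apply: eq_big => [[i j]|[i j] _] //=; rewrite inE.
apply: eq_bigr => j _; case: (f j) => [i|]; last by rewrite big_pred0.
by rewrite (big_pred1 i) // => i' /=; rewrite eq_sym.
Qed.

Lemma prod_square_weight T :
  \prod_(s in T) square_weight s = 'X^(below T) * (1 + 'X) ^+ nrow T.
Proof.
rewrite big_split /= !prodrXr; congr (_ * _ ^+ _).
rewrite /nrow -sum1_card big_mkcond [RHS]big_mkcond /=.
by apply: eq_bigr => s _; rewrite !inE; case: (s \in T) => //=; case: eqP.
Qed.

Lemma card_squares_below s :
  s \in board n -> #|squares_below s| = (n - s.1 - s.2)%N.
Proof.
case: s => i j; rewrite inE /= => /and3P[i0 j0 leij].
have lt_row (d : 'I_(n - i - j)) : (i + d.+1 < n)%N.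
  by have := ltn_ord d; lia.
have inj : injective (fun d : 'I_(n - i - j) => (Ordinal (lt_row d), j)).
  by move=> d d' [] /= ?; apply: val_inj => /=; lia.
rewrite -[RHS]card_ord -(card_imset _ inj); apply: eq_card => -[i' j'].
rewrite !inE /=; apply/idP/imsetP => [|[d _ [-> ->]] /=].
  case/andP=> /and3P[_ _ le'] /andP[/eqP ejj ltii].
  have ltd : (i' - i.+1 < n - i - j)%N by rewrite -ejj; lia.
  exists (Ordinal ltd) => //; rewrite ejj; congr (_, _).
  by apply: val_inj => /=; lia.
by rewrite eqxx /=; have := ltn_ord d; lia.
Qed.

Lemma column_weight (j : 'I_n) : (0 < j)%N ->
  \sum_(i | (i, j) \in shaded n) square_weight (i, j) = qnat (n - j).
Proof.
move=> j0; rewrite -qnat_even_sum.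
(* The square of column [j] with [e] squares below it lies in row [n - j - e]. *)
have lt_row (e : 'I_(n - j)) : (n - j - e < n)%N by have := ltn_ord j; lia.
pose row e := Ordinal (lt_row e).
have shE (e : 'I_(n - j)) : ((row e, j) \in shaded n) = ~~ odd e.
  rewrite !inE /=; have lte := ltn_ord e.
  have -> : (n - (n - j - e) - j = e)%N by lia.
  by case: odd; rewrite ?andbF ?andbT //=; lia.
rewrite (reindex row) /=; last first.
  (* The inverse is [n - j - i]; the correction at the off-board row 0 only keeps the value in
     range. *)
  have lt_ei (i : 'I_n) : (n - j - i - (i == 0%N :> nat) < n - j)%N.
    by have := ltn_ord j; case: eqP; lia.
  exists (fun i => Ordinal (lt_ei i)) => [e _|i shi]; apply: val_inj => /=.
    by have := ltn_ord e; case: eqP; lia.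
  by move: shi; rewrite !inE /= => /andP[/and3P[]]; case: eqP; lia.
apply: eq_big => [e|e]; first exact: shE.
move=> sh; rewrite /square_weight card_squares_below; last first.
  by move: sh; rewrite inE => /andP[].
have lte := ltn_ord e; rewrite /=.
have -> : (n - (n - j - e) - j = e)%N by lia.
by have -> : (n - j - e == 1)%N = (e.+1 == n - j)%N by lia.
Qed.

(** The outer variable marks empty columns, and its coefficients are polynomials in q. An unshaded
    square gets weight 0, which discards the placements using it. *)
Definition choice_weight (j : 'I_n) (o : option 'I_n) : {poly {poly int}} :=
  if o is Some i then
    if (i, j) \in shaded n then (square_weight (i, j))%:P else 0
  else 'X.

Lemma sum_choice_weight (j : 'I_n) :
  \sum_o choice_weight j o =
  'X + (if j == 0%N :> nat then 0 else qnat (n - j))%:P.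
Proof.
rewrite (bigD1 None) //=; congr (_ + _).
rewrite (reindex_omap Some id) /=; last by case.
rewrite (eq_bigl xpredT) => [|i]; last by rewrite eqxx.
rewrite -big_mkcond /= -rmorph_sum /=; congr _%:P.
(* Column 0 is off the board, so only the empty choice survives there. *)
case: eqP => [j0|/eqP]; last by rewrite -lt0n; apply: column_weight.
by rewrite big_pred0 // => i; rewrite !inE /= j0 andbF.
Qed.

Lemma prod_sum_choice_weight :
  \prod_j \sum_o choice_weight j o = \prod_(j < n) ('X + (qnat j)%:P).
Proof.
under eq_bigr do rewrite sum_choice_weight.
case: n => [|m]; first by rewrite !big_ord0.
rewrite !big_ord_recl /= {2}/qnat big_ord0; congr (_ * _).
(* Column 0 has matched the factor X + [0]_q = X; reversing the other columns turns [n - j]_q into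
   [j]_q. *)
rewrite (reindex_inj rev_ord_inj); apply: eq_bigr => i _ /=.
by rewrite /bump /= !add1n subSS subKn.
Qed.

Lemma prod_choice_weight f :
  \prod_j choice_weight j (f j) =
  if rook_set f \subset shaded n
  then (\prod_(s in rook_set f) square_weight s)%:P * 'X^(n - #|rook_set f|)
  else 0.
Proof.
case: ifPn => [/subsetP sh|/subsetPn[[i j]]]; last first.
  by rewrite inE /= => /eqP fj nsh; rewrite (bigD1 j) //= fj /= (negPf nsh) mul0r.
(* The exponent is the number of empty columns. *)
have -> : (n - #|rook_set f| = \sum_j (f j == None))%N.
  apply/eqP; rewrite -sum1_card big_rook_set -{1}(card_ord n) -sum1_card.
  rewrite -sumnB => [|j _]; last by case: (f j).
  by apply/eqP/eq_bigr => j _; case: (f j).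
rewrite big_rook_set rmorph_prod -prodrXr -big_split; apply: eq_bigr => j _ /=.
case fj: (f j) => [i|] /=; last by rewrite mul1r.
by rewrite sh ?mulr1 // inE /= fj.
Qed.

Lemma card_rook_set f : (#|rook_set f| <= n)%N.
Proof.
rewrite -sum1_card big_rook_set -[leqRHS]card_ord -sum1_card.
by apply: leq_sum => j _; case: (f j).
Qed.

End PartialFunctions.

Theorem theorem7p4 (n k : nat) (hn : (1 <= n)%N) (hk : (k <= n)%N) :
  cq n k = \sum_(T in alt_placements n (n - k))
             'X^(below T) * (1 + 'X) ^+ nrow T.
Proof.
rewrite -coef_prod_qnat -prod_sum_choice_weight bigA_distr_bigA coef_sum.
(* The sum over placements becomes a sum over partial functions, [column_choice] being the inverse
   on placements. *)
rewrite (reindex (rook_set n)) /=; last first.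
  exists (column_choice n) => [f _|T]; first exact: rook_setK.
  by rewrite inE => /andP[/column_choiceK].
rewrite [RHS]big_mkcond; apply: eq_bigr => f _.
rewrite prod_choice_weight inE rook_set_placement -prod_square_weight.
case: ifP => [sh|_]; last by rewrite andbF coef0.
have -> : rook_set n f \subset board n.
  by apply: subset_trans sh _; apply/subsetP => s; rewrite inE => /andP[].
rewrite andbT coefCM coefXn /=.
(* Having [k] empty columns amounts to having [n - k] rooks, as both [k] and the number of rooks are
   at most [n]. *)
have -> : (k == n - #|rook_set n f|)%N = (#|rook_set n f| == n - k)%N.
  by have := card_rook_set n f; lia.
by case: eqP; rewrite ?mulr1 ?mulr0.
Qed.
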